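(* Let $n$ be a positive integer and suppose that $f\in\mathbb{R}_{n}^{+}$. Then for every $m\in\{1,\ldots,n\}$ there exists a polynomial $g\in\mathcal{H}_{m}$ such that $f\bullet g\subset\mathcal{H}_{m}$.
   Context: For an integer $k\ge 0$, $\mathbb{R}_k^+$ denotes the set of real polynomials $s\mapsto c_0+c_1s+\ldots+c_ks^k$ with all $c_i>0$ ($i=0,\ldots,k$). For $k\ge 1$, $\mathcal{H}_k$ is the set of $f\in\mathbb{R}_k^+$ all of whose complex zeros have negative real part (Hurwitz stable polynomials). For $f(s)=\sum_{i=0}^n a_is^i\in\mathbb{R}_n^+$ and $g(s)=\sum_{i=0}^m b_is^i\in\mathbb{R}_m^+$ with $m\le n$, the generalized Hadamard product of $f$ and $g$ is the set $f\bullet g=\{F_0,\ldots,F_{n-m}\}$, where $F_j(s)=\sum_{i=0}^m a_{j+i}b_is^i$ for $j=0,\ldots,n-m$. *)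

(* Defs.v *)
From HB Require Import structures.
From mathcomp Require Import all_boot all_order all_algebra.
From mathcomp Require Import classical_sets reals.
From mathcomp Require Import complex.

Set Implicit Arguments.
Unset Strict Implicit.
Unset Printing Implicit Defensive.

Import Order.TTheory GRing.Theory Num.Theory.
Local Open Scope ring_scope.
Local Open Scope classical_set_scope.

(* The real numbers are an arbitrary [R : realType],
   the complex numbers are [R[i]] from mathcomp-real-closed. *)

Definition pos_poly (R : realType) (k : nat) : set {poly R} :=
  [set p | size p = k.+1 /\ forall i : nat, (i <= k)%N -> 0 < p`_i].

Definition hurwitz (R : realType) (k : nat) : set {poly R} :=
  [set p | pos_poly k p /\
     forall z : R[i], root (map_poly (real_complex R) p) z ->
       complex.Re z < 0].

Definition hadamard_shift (R : realType) (m : nat) (f g : {poly R}) (j : nat) :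
    {poly R} :=
  \poly_(i < m.+1) (f`_(j + i)%N * g`_i).

(* Meaningful for [f] of degree [n], [g] of degree [m] and [m <= n], so that
   [n - m] is not truncated. *)
Definition gen_hadamard (R : realType) (n m : nat) (f g : {poly R}) :
    set {poly R} :=
  [set hadamard_shift m f g j | j in [set j : nat | (j <= n - m)%N]].

(* Main.v *)
Require Import Defs.
From HB Require Import structures.
From mathcomp Require Import all_boot all_order all_algebra.
From mathcomp Require Import classical_sets reals.
From mathcomp Require Import complex.
From mathcomp Require Import ring zify.

(** If the coefficients satisfy [c_i c_(i+2) <= c_(i+1)^2 / (m+1)], the
    polynomial is Hurwitz: for [Re z >= 0], [z <> 0], choose [i] maximizing
    [c_j |z|^j] and divide [p(z)] by [z^i].  The terms of index [i-1], [i+1]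
    become [c_(i-1) / z] and [c_(i+1) z], of nonnegative real part, and each of
    the others has modulus at most [c_i / (m+1)], so that the real part of the
    sum is positive.  Taking [g] with coefficients [e^(i^2)] multiplies each
    quotient [c_i c_(i+2) / c_(i+1)^2] of a window of [f] by [e^2]; a small [e]
    serves [g] and all the windows at once. *)

Set Implicit Arguments.
Unset Strict Implicit.
Unset Printing Implicit Defensive.

Import Order.TTheory GRing.Theory Num.Theory.
Local Open Scope ring_scope.
Local Open Scope classical_set_scope.

(** The hypothesis says that each ratio [u j.+2 / u j.+1] is at most [1/K] times the preceding
    ratio. The first ratio is at most 1 by maximality of [u 0], so all ratios are at most 1, and
    from the second on at most [1/K]. *)
Lemma log_concave_tail (R : realFieldType) (K : R) (k : nat) (u : nat -> R) :
  1 <= K ->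
  (forall j, (j <= k)%N -> 0 < u j <= u 0%N) ->
  (forall j, (j.+2 <= k)%N -> K * (u j * u j.+2) <= u j.+1 ^+ 2) ->
  forall j, (1 < j <= k)%N -> K * u j <= u 0%N.
Proof.
move=> K1 u_max u_lc.
have u_gt0 j : (j <= k)%N -> 0 < u j by case/u_max/andP.
have step j : (j.+2 <= k)%N -> u j.+1 <= u j -> K * u j.+2 <= u j.+1.
  move=> jk le1; rewrite -(ler_pM2l (u_gt0 j _)); last by lia.
  rewrite mulrCA (le_trans (u_lc j jk)) // expr2 ler_wpM2r // ltW // u_gt0 //.
  by lia.
have mono j : (j.+1 <= k)%N -> u j.+1 <= u j.
  elim: j => [|j IHj] jk; first by case/andP: (u_max _ jk).
  apply: le_trans (step j jk (IHj _)); last by lia.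
  by rewrite ler_peMl // ltW // u_gt0.
case=> [|[|j]] // /andP[_ jk].
apply: le_trans (step j jk (mono _ _)) _; first by lia.
by have /u_max/andP[] : (j.+1 <= k)%N by lia.
Qed.

Lemma Re_ge_normc (R : rcfType) (w : R[i]) : - Normc.normc w <= complex.Re w.
Proof.
case: w => a b /=; apply: lerNnormlW; rewrite -sqrtr_sqr ler_wsqrtr //.
by rewrite lerDl sqr_ge0.
Qed.

Lemma ReV_ge0 (R : rcfType) (w : R[i]) :
  0 <= complex.Re w -> 0 <= complex.Re w^-1.
Proof. by case: w => a b /= a0; rewrite divr_ge0 ?addr_ge0 ?sqr_ge0. Qed.

Lemma Re_sum_coef (R : rcfType) (n : nat) (c : 'I_n -> R) (w : 'I_n -> R[i]) :
  complex.Re (\sum_i (c i)%:C%C * w i) = \sum_i c i * complex.Re (w i).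
Proof.
apply: (big_ind2 (fun x y => complex.Re x = y)) => //.
  by move=> [a b] _ [a' b'] _ <- <-.
by move=> i _; case: (w i) => a b /=; rewrite mul0r subr0.
Qed.

Lemma normcX (R : rcfType) (z : R[i]) k :
  Normc.normc (z ^+ k) = Normc.normc z ^+ k.
Proof.
by elim: k => [|k IHk]; rewrite ?expr0 ?Normc.normc1 // !exprS Normc.normcM IHk.
Qed.

Lemma log_concave_hurwitz (R : realType) (m : nat) (p : {poly R}) :
  pos_poly m p ->
  (forall i, (i.+2 <= m)%N -> m.+1%:R * (p`_i * p`_i.+2) <= p`_i.+1 ^+ 2) ->
  hurwitz m p.
Proof.
move=> [sp p_gt0] p_lc; split=> // z /rootP pz.
rewrite ltNge; apply/negP => Rez.
have pzE : \sum_(j < m.+1) (p`_j)%:C%C * z ^+ j = 0.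
  rewrite -[RHS]pz horner_coef size_map_poly sp; apply: eq_bigr => j _.
  by rewrite coef_map.
have z0 : z != 0.
  apply/eqP => z0; move: pzE; rewrite z0 big_ord_recl expr0 mulr1 big1.
  2: by move=> j _; rewrite expr0n mulr0.
  by rewrite addr0 => -[] /eqP; rewrite gt_eqF ?p_gt0.
have r_gt0 : 0 < Normc.normc z.
  rewrite lt_def; apply/andP; split.
    by apply: contra z0 => /eqP/Normc.eq0_normc ->.
  by case: (z) => a b; rewrite sqrtr_ge0.
set r := Normc.normc z in r_gt0.
pose u j := p`_j * r ^+ j.
have u_gt0 j : (j <= m)%N -> 0 < u j.
  by move=> jm; rewrite mulr_gt0 ?exprn_gt0 ?p_gt0.
(* Passing from [p] to [u] multiplies both sides by [r ^+ (2 * j.+1)]. *)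
have u_lc j : (j.+2 <= m)%N -> m.+1%:R * (u j * u j.+2) <= u j.+1 ^+ 2.
  move=> /p_lc; rewrite -(ler_pM2r (exprn_gt0 (j.+1).*2 r_gt0)).
  rewrite /u exprMn -exprM muln2; congr (_ <= _).
  have -> : r ^+ j.+1.*2 = r ^+ j * r ^+ j.+2.
    by rewrite -exprD; congr (_ ^+ _); lia.
  by ring.
have [i _ i_max] := @Order.TotalTheory.arg_maxP _ _ _ ord0 xpredT
  (fun j : 'I_m.+1 => u j) isT.
have u_max j : (j <= m)%N -> 0 < u j <= u i.
  move=> jm; rewrite u_gt0 //=.
  by have := i_max (Ordinal (jm : (j < m.+1)%N)) isT.
have K1 : 1 <= m.+1%:R :> R by rewrite ler1n.
have im : (i <= m)%N by rewrite -ltnS.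
(* The inequality [u_lc] is symmetric under reversal of indices, so the tail bound applies both to
   the right and to the left of the maximal term. *)
have far j : (j <= m)%N -> (i.+1 < j)%N || (j.+1 < i)%N ->
    m.+1%:R * u j <= u i.
  move=> jm /orP[ij|ji].
    have -> : u j = u (i + (j - i))%N by congr u; lia.
    have -> : u i = u (i + 0)%N by rewrite addn0.
    apply: (@log_concave_tail R _ (m - i)%N (fun a => u (i + a)%N));
      last by lia.
    - by [].
    - by move=> a am; rewrite addn0 u_max //; lia.
    - by move=> a am; rewrite !addnS u_lc //; lia.
  have -> : u j = u (i - (i - j))%N by congr u; lia.
  have -> : u i = u (i - 0)%N by rewrite subn0.
  apply: (@log_concave_tail R _ i (fun a => u (i - a)%N)); last by lia.
  - by [].
  - by move=> a am; rewrite subn0 u_max //; lia.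
  - move=> a am; have := u_lc (i - a.+2)%N; rewrite mulrC.
    have -> : (i - a.+2).+2 = (i - a)%N by lia.
    have -> : (i - a.+2).+1 = (i - a.+1)%N by lia.
    by rewrite [u (i - a.+2)%N * _]mulrC [_ * m.+1%:R]mulrC; apply; lia.
have zi0 : z ^+ i != 0 by rewrite expf_neq0.
have term (j : 'I_m.+1) : j != i ->
    - (p`_i / m.+1%:R) <= p`_j * complex.Re (z ^+ j / z ^+ i).
  move=> ji; have pj : 0 < p`_j by rewrite p_gt0 // -ltnS.
  have pi_gt0 : 0 < p`_i / m.+1%:R by rewrite divr_gt0 ?p_gt0 ?ltr0n.
  have jm : (j <= m)%N by rewrite -ltnS.
  have [farj|nearj] := boolP ((i.+1 < j)%N || (j.+1 < i)%N).
    apply: le_trans (ler_wpM2l (ltW pj) (Re_ge_normc _)).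
    rewrite Normc.normcM Normc.normcV !normcX -/r mulrN lerN2 mulrA.
    rewrite ler_pdivlMr ?ltr0n // mulrAC ler_pdivrMr ?exprn_gt0 //.
    by rewrite mulrC far.
  (* For a neighbour of [i] the quotient is [z] or [z^-1], and both have nonnegative real part. *)
  apply: (@le_trans _ _ 0); first by rewrite oppr_le0 ltW.
  apply: mulr_ge0; first exact: ltW.
  have [ij|ij] : j = i.+1 :> nat \/ i = j.+1 :> nat.
    by move: ji; rewrite -val_eqE /=; lia.
    by rewrite ij exprS mulfK.
  have zj0 : z ^+ j != 0 by rewrite expf_neq0.
  by rewrite ij exprS invfM mulrCA divff // mulr1 ReV_ge0.
have : \sum_(j < m.+1) (p`_j)%:C%C * (z ^+ j / z ^+ i) = 0.
  by under eq_bigr do rewrite mulrA; rewrite -mulr_suml pzE mul0r.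
move=> /(congr1 (@complex.Re R)); rewrite Re_sum_coef (bigD1 i) //= divff //=.
rewrite mulr1 => sum0.
have rest_ge : \sum_(j < m.+1 | j != i) - (p`_i / m.+1%:R) <=
    \sum_(j < m.+1 | j != i) p`_j * complex.Re (z ^+ j / z ^+ i).
  exact: ler_sum.
move: rest_ge; rewrite (eq_bigl [in predC1 i]) // sumr_const cardC1 card_ord.
apply/negP; rewrite -ltNge -(ltrD2l p`_i) sum0 /= -[_ *+ m]mulr_natr.
have pi_gt0 : 0 < p`_i by rewrite p_gt0.
by rewrite mulNr subr_gt0 mulrAC ltr_pdivrMr ?ltr0n // ltr_pM2l // ltr_nat.
Qed.

(** Finitely many positive ratios have a positive lower bound; each induction step takes the minimum
    with the ratio of the last triple. *)
Lemma exists_log_concave_scale (R : realFieldType) (K : R) (n : nat)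
    (a : nat -> R) :
  0 < K -> (forall i, (i <= n)%N -> 0 < a i) ->
  exists2 e : R, 0 < e <= 1 & forall i, (i.+2 <= n)%N ->
    e * (K * (a i * a i.+2)) <= a i.+1 ^+ 2.
Proof.
move=> K0; elim: n => [|n IHn] a_gt0; first by exists 1; rewrite ?ltr01 ?lexx.
have [i ni|e /andP[e0 e1] e_lc] := IHn; first by rewrite a_gt0 // ltnW.
case: n => [|n] in a_gt0 e_lc IHn *.
  by exists 1; rewrite ?ltr01 ?lexx //; case.
set d := K * (a n * a n.+2); set s := a n.+1 ^+ 2.
have d0 : 0 < d by rewrite !mulr_gt0 ?a_gt0 //; lia.
have s0 : 0 < s by rewrite exprn_gt0 ?a_gt0.
have sd0 : 0 < s / d by rewrite divr_gt0.
exists (Num.min e (s / d)).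
  by rewrite lt_min e0 sd0 ge_min e1.
move=> i; rewrite leq_eqVlt => /orP[/eqP[->]|].
  by rewrite -/d -/s -ler_pdivlMr // ge_min lexx orbT.
rewrite ltnS => ni; apply: le_trans (e_lc i ni).
rewrite ler_wpM2r ?ge_min ?lexx // ltW // !mulr_gt0 ?a_gt0 //; lia.
Qed.

Theorem theorem7 (R : realType) (n : nat) (hn : (0 < n)%N)
    (f : {poly R}) (hf : pos_poly n f) (m : nat)
    (hm : (1 <= m <= n)%N) :
  exists2 g : {poly R}, hurwitz m g & gen_hadamard n m f g `<=` hurwitz m.
Proof.
have K0 : 0 < m.+1%:R :> R by rewrite ltr0n.
have [_ f_gt0] := hf; have /andP[_ mn] := hm.
have [e1 /andP[e1_gt0 e1_le1] e1_lc] :=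
  exists_log_concave_scale K0 f_gt0.
have [//|e2 /andP[e2_gt0 e2_le1] e2_lc] :=
  @exists_log_concave_scale R m.+1%:R m (fun=> 1) K0.
(* The product [e1 * e2] serves without square roots: both factors are at most 1, so its square is
   at most itself, hence at most each factor. *)
have [e e_gt0 [e_le1 e_le2]] :
    exists2 e : R, 0 < e & e ^+ 2 <= e1 /\ e ^+ 2 <= e2.
  have e12_gt0 : 0 < e1 * e2 by rewrite mulr_gt0.
  have e12_le1 : e1 * e2 <= e1 by rewrite ler_piMr // ltW.
  have e12_le2 : e1 * e2 <= e2 by rewrite ler_piMl // ltW.
  have e12_sqr : (e1 * e2) ^+ 2 <= e1 * e2.
    by rewrite expr2 ler_piMl ?(le_trans e12_le1) // ltW.
  by exists (e1 * e2) => //; split; apply: le_trans e12_sqr _.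
(* This covers [g] itself, with [c] constantly 1, and every window of [f]. *)
have windowP (c : nat -> R) : (forall i, (i <= m)%N -> 0 < c i) ->
    (forall i, (i.+2 <= m)%N ->
      e ^+ 2 * (m.+1%:R * (c i * c i.+2)) <= c i.+1 ^+ 2) ->
    hurwitz m (\poly_(i < m.+1) (c i * e ^+ (i ^ 2))).
  move=> c_gt0 c_lc.
  have ce_gt0 i : (i <= m)%N -> 0 < c i * e ^+ (i ^ 2).
    by move=> im; rewrite mulr_gt0 ?exprn_gt0 ?c_gt0.
  apply: log_concave_hurwitz => [|i im].
    split; first by rewrite size_poly_eq // gt_eqF ?ce_gt0.
    by move=> i im; rewrite coef_poly ltnS im ce_gt0.
  rewrite !coef_poly !ltnS im !ifT; [|lia..].
  (* Squares have constant second difference 2, which yields the factor [e ^+ 2]. The subtraction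
     does not truncate. *)
  have -> : (i.+2 ^ 2 = 2 + 2 * i.+1 ^ 2 - i ^ 2)%N by lia.
  have := c_lc i im; rewrite -(ler_pM2r (exprn_gt0 (i.+1 ^ 2 * 2) e_gt0)).
  rewrite exprMn -exprM; congr (_ <= _).
  rewrite mulrAC; suff -> : e ^+ 2 * e ^+ (i.+1 ^ 2 * 2) =
    e ^+ (i ^ 2) * e ^+ (2 + 2 * i.+1 ^ 2 - i ^ 2) by ring.
  by rewrite -!exprD; congr (_ ^+ _); lia.
exists (\poly_(i < m.+1) (1 * e ^+ (i ^ 2))).
  apply: (windowP (fun=> 1)) => // i im; apply: le_trans (e2_lc i im).
  by rewrite ler_wpM2r // !mulr_ge0.
move=> _ [j /= jn <-].
have -> : hadamard_shift m f (\poly_(i < m.+1) (1 * e ^+ (i ^ 2))) j =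
    \poly_(i < m.+1) (f`_(j + i) * e ^+ (i ^ 2)).
  by apply: eq_poly => i im; rewrite coef_poly im mul1r.
apply: (windowP (fun i => f`_(j + i))) => i im.
  by apply: f_gt0; lia.
have ji : ((j + i).+2 <= n)%N by lia.
rewrite !addnS; apply: le_trans (e1_lc _ ji).
by rewrite ler_wpM2r // ltW // !mulr_gt0 // f_gt0 //; lia.
Qed.
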